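(* A metric space $(X,d)$ is Lipschitz realcompact (that is, $X=H(Lip_d(X))$) if and only if it satisfies the Heine-Borel property, i.e., every closed and $d$-bounded subset of $X$ is compact.
   Context: For a metric space $(X,d)$, $Lip_d(X)$ is the unital vector lattice of all real-valued Lipschitz functions on $X$. The Lipschitz realcompactification $H(Lip_d(X))$ is the space of unital vector lattice homomorphisms $Lip_d(X)\to\mathbb{R}$ with the topology of pointwise convergence, in which $X$ is embedded as a dense subspace via evaluations at points; equivalently, it is the smallest realcompactification of $X$ to which every $f\in Lip_d(X)$ extends to a continuous real-valued function. (A realcompactification is a realcompact Tychonoff space containing $X$ as a dense subspace; $\alpha_1X\le\alpha_2X$ means that there is a continuous map $\alpha_2X\to\alpha_1X$ leaving $X$ pointwise fixed.) $X$ is Lipschitz realcompact if $X=H(Lip_d(X))$. *)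

(* Defs.v *)
From HB Require Import structures.
From mathcomp Require Import all_boot all_order all_algebra.
From mathcomp Require Import boolp classical_sets functions reals topology normedtype.

Set Implicit Arguments.
Unset Strict Implicit.
Unset Printing Implicit Defensive.

Import Order.TTheory GRing.Theory Num.Theory.
Import numFieldNormedType.Exports.

Local Open Scope classical_set_scope.
Local Open Scope ring_scope.

Section LipschitzLattice.
Context {R : realType} (X : metricType R).

Definition is_lipschitz (f : X -> R) : Prop :=
  exists k : R, forall x y : X, `|f x - f y| <= k * mdist x y.

Definition lip_pred : {pred X -> R} := fun f => `[< is_lipschitz f >].

Lemma lip_predP f : reflect (is_lipschitz f) (f \in lip_pred).
Proof. exact: asboolP. Qed.

Lemma lip_submod_closed : @submod_closed R (X -> R) lip_pred.
Proof.
split=> [|a f g /lip_predP[k fk] /lip_predP[l gl]]; apply/lip_predP.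
  by exists 0 => x y; rewrite mul0r subrr normr0.
exists (`|a| * k + l) => x y.
have -> : (a *: f + g) x - (a *: f + g) y = a * (f x - f y) + (g x - g y).
  by rewrite mulrBr addrACA -opprD.
rewrite (le_trans (ler_normD _ _))// mulrDl lerD// normrM -mulrA.
by rewrite ler_wpM2l.
Qed.

HB.instance Definition _ :=
  GRing.isSubmodClosed.Build R (X -> R) lip_pred lip_submod_closed.

Lemma lip_common f g : f \in lip_pred -> g \in lip_pred ->
  exists k, forall x y, `|f x - f y| <= k * mdist x y /\
                        `|g x - g y| <= k * mdist x y.
Proof.
move=> /lip_predP[k fk] /lip_predP[l gl]; exists (Num.max k l) => x y; split.
  by rewrite (le_trans (fk x y))// ler_wpM2r ?mdist_ge0// le_max lexx.
by rewrite (le_trans (gl x y))// ler_wpM2r ?mdist_ge0// le_max lexx orbT.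
Qed.

Lemma lip_meet_closed : {in lip_pred &, forall f g, (f `&` g)%O \in lip_pred}.
Proof.
move=> f g flip glip; have [k fgk] := lip_common flip glip.
apply/lip_predP; exists k => x y; have [] := fgk x y.
rewrite !meetfE !meetEtotal !ler_norml !lerBlDr !lerBrDr.
move=> /andP[f1 f2] /andP[g1 g2]; apply/andP; split.
  rewrite le_min; apply/andP; split.
    by rewrite (le_trans _ f1)// lerD2l ge_min lexx.
  by rewrite (le_trans _ g1)// lerD2l ge_min lexx orbT.
have [_|_] := leP (f y) (g y); first by rewrite ge_min f2.
by rewrite ge_min g2 orbT.
Qed.

Lemma lip_join_closed : {in lip_pred &, forall f g, (f `|` g)%O \in lip_pred}.
Proof.
move=> f g flip glip; have [k fgk] := lip_common flip glip.
apply/lip_predP; exists k => x y; have [] := fgk x y.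
rewrite !joinfE !joinEtotal !ler_norml !lerBlDr !lerBrDr.
move=> /andP[f1 f2] /andP[g1 g2]; apply/andP; split.
  have [_|_] := leP (f y) (g y); first by rewrite le_max g1 orbT.
  by rewrite le_max f1.
rewrite ge_max; apply/andP; split.
  by rewrite (le_trans f2)// lerD2l le_max lexx.
by rewrite (le_trans g2)// lerD2l le_max lexx orbT.
Qed.

HB.instance Definition _ := Order.isLatticeClosed.Build _ (X -> R) lip_pred
  lip_meet_closed lip_join_closed.

Record Lip := MkLip { lip_fun :> X -> R ; _ : lip_fun \in lip_pred }.

HB.instance Definition _ := [isSub for lip_fun].
HB.instance Definition _ := [Choice of Lip by <:].
HB.instance Definition _ := [SubChoice_isSubLmodule of Lip by <:].
HB.instance Definition _ := [SubChoice_isSubLattice of Lip by <: with FunOrder.fun_display].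

Lemma lip_cst1 : (cst 1 : X -> R) \in lip_pred.
Proof. by apply/lip_predP; exists 0 => x y; rewrite mul0r subrr normr0. Qed.

Definition lip_unit : Lip := MkLip lip_cst1.

Definition unital_lattice_hom (phi : Lip -> R) : Prop :=
  [/\ scalar phi,
      {morph phi : f g / (f `&` g)%O >-> Num.min f g},
      {morph phi : f g / (f `|` g)%O >-> Num.max f g}
    & phi lip_unit = 1].

Definition lip_homs : set {ptws Lip -> R} := [set phi | unital_lattice_hom phi].

(* The subspace topology inherited from the topology of pointwise convergence *)
Definition lip_realcompactification : topologicalType := set_type lip_homs.

Lemma lip_eval_subproof (x : X) : (fun f : Lip => f x) \in lip_homs.
Proof.
rewrite inE; split=> // f g.
- by rewrite -(meetEtotal (f x)) -(meetfE (f : X -> R)).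
- by rewrite -(joinEtotal (f x)) -(joinfE (f : X -> R)).
Qed.

Definition lip_eval (x : X) : lip_realcompactification :=
  exist _ (fun f : Lip => f x) (lip_eval_subproof x).

End LipschitzLattice.

Arguments lip_homs {R} X.

Definition homeomorphism (S T : topologicalType) (h : S -> T) : Prop :=
  continuous h /\ exists g, [/\ cancel h g, cancel g h & continuous g].

(* The equality X = H(Lip_d(X)) is one of realcompactifications of X, i.e. the
   canonical map itself has to be a homeomorphism. *)
Definition lipschitz_realcompact (R : realType) (X : metricType R) : Prop :=
  homeomorphism (@lip_eval R X : X -> lip_realcompactification X).

Definition mbounded (R : realType) (X : metricType R) (A : set X) : Prop :=
  exists M : R, forall x y, A x -> A y -> mdist x y <= M.

Definition heine_borel (R : realType) (X : metricType R) : Prop :=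
  forall A : set X, closed A -> mbounded A -> compact A.

(* Main.v *)
Require Import Defs.
From mathcomp Require Import all_boot all_order all_algebra.
From mathcomp Require Import reals topology.
From mathcomp Require Import boolp classical_sets functions mathcomp_extra.
From mathcomp Require Import normedtype.

Set Implicit Arguments.
Unset Strict Implicit.
Unset Printing Implicit Defensive.

Import Order.TTheory GRing.Theory Num.Theory.
Import numFieldNormedType.Exports.

Local Open Scope classical_set_scope.
Local Open Scope ring_scope.

(** Every Lipschitz function is bounded on bounded sets, and the distance to a
    point is Lipschitz: these two facts tie the unital lattice homomorphisms
    on [Lip X] to the bounded subsets of [X].

    Suppose [X] has the Heine-Borel property, and let [phi] be a unital
    lattice homomorphism. If [phi] vanishes on a nonnegative [h], then [h] takes
    arbitrarily small values, since [h >= e] would give [phi h >= e]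
    ([hom_lt_ex]). Such [h] are closed under sums, so the sets [h < e] generate
    a proper filter ([null_filter]); along it every [f] tends to [phi f],
    because [phi] kills [|f - phi f|] ([null_filter_near]). Applied to the
    distance to a point, this places the filter on a closed ball, which is
    compact; a cluster point [x] then satisfies [f x = phi f] for all [f]. Thus
    the evaluation map is onto. It is a homeomorphism onto its image in every
    metric space: the inverse is continuous because [p] tends to [lip_eval x]
    only if the value of [p] at the distance to [x] tends to [0].

    Conversely, let [A] be closed and bounded and let [F] be an ultrafilter on
    [A]. Every Lipschitz function is bounded on [A], so it has a limit along [F]
    ([ultra_lip_cvg]), and these limits form a unital lattice homomorphism
    ([ultra_lim_hom]). If that homomorphism is the evaluation at [x], then the
    distance to [x] tends to [0] along [F], that is, [F] converges to [x]; and
    [x] lies in [A] as [A] is closed. Hence [A] is compact. *)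

(** * Lipschitz functions as a pointwise vector lattice *)

Section PointwiseOperations.
Context {R : realType} {X : metricType R}.
Implicit Types (f g : Lip X) (x y : X).

Lemma lip_meetE f g x : (f `&` g)%O x = Num.min (f x) (g x).
Proof. by case/set_mem: (lip_eval_subproof x) => _ + _ _; apply. Qed.

Lemma lip_joinE f g x : (f `|` g)%O x = Num.max (f x) (g x).
Proof. by case/set_mem: (lip_eval_subproof x) => _ _ + _; apply. Qed.

Lemma lip_ext f g : (forall x, f x = g x) -> f = g.
Proof. by move=> fg; apply/val_inj/funext. Qed.

Lemma lipP f : is_lipschitz (f : X -> R).
Proof. by apply/lip_predP; case: f. Qed.

Lemma lip_continuous f : continuous (f : X -> R).
Proof.
have [k fk] := lipP f.
move=> x; apply/cvgrPdist_lt => e e0.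
(* The given Lipschitz constant may be zero or negative. *)
have k0 : 0 < Num.max k 1 by rewrite lt_max ltr01 orbT.
have : \forall y \near x, mdist x y < e / Num.max k 1.
  apply: (@metricType_numDomainType.cvgr_dist_lt R X _ (nbhs x)) => //.
  by rewrite divr_gt0.
apply: filterS => y; rewrite ltr_pdivlMr// mulrC; apply: le_lt_trans.
by rewrite (le_trans (fk x y))// ler_wpM2r ?mdist_ge0// le_max lexx.
Qed.

Lemma mdist_lipschitz x : mdist x \in lip_pred (X := X).
Proof.
apply/lip_predP; exists 1 => y z; rewrite mul1r ler_norml lerBlDr lerNl opprB.
rewrite lerBlDr; apply/andP; split; last first.
  by rewrite addrC (metric_sym y z) metric_triangle.
by rewrite addrC metric_triangle.
Qed.

Definition dist_from x : Lip X := MkLip (mdist_lipschitz x).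

(** The function [x |-> `|f x - a|], built from the lattice operations alone so
    that a lattice homomorphism can be pushed through it. *)
Definition lip_dev f (a : R) : Lip X :=
  let g := f - a *: lip_unit X in (g `|` - g)%O.

Lemma lip_devE f a x : lip_dev f a x = `|f x - a|.
Proof.
rewrite /lip_dev lip_joinE maxrN; congr (`| f x - _ |).
by rewrite -[RHS]mulr1.
Qed.

End PointwiseOperations.

(** * Unital lattice homomorphisms under the Heine-Borel property *)

Section Homomorphisms.
Context {R : realType} {X : metricType R} {phi : Lip X -> R}.
Hypothesis phiH : unital_lattice_hom phi.
Implicit Types (f g : Lip X) (x y : X).

Lemma homZD (a : R) f g : phi (a *: f + g) = a * phi f + phi g.
Proof. by case: phiH => + _ _ _; apply. Qed.

Lemma hom1 : phi (lip_unit X) = 1.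
Proof. by case: phiH. Qed.

Lemma homU f g : phi (f `|` g)%O = Num.max (phi f) (phi g).
Proof. by case: phiH => _ _ + _; apply. Qed.

Lemma hom0 : phi 0 = 0.
Proof. by have := homZD (-1) 0 0; rewrite scaler0 addr0 mulN1r addNr. Qed.

Lemma homZ (a : R) f : phi (a *: f) = a * phi f.
Proof. by rewrite -[a *: f]addr0 homZD hom0 addr0. Qed.

Lemma homD f g : phi (f + g) = phi f + phi g.
Proof. by rewrite -[f in LHS]scale1r homZD mul1r. Qed.

Lemma homN f : phi (- f) = - phi f.
Proof. by rewrite -scaleN1r homZ mulN1r. Qed.

Lemma hom_dev f : phi (lip_dev f (phi f)) = 0.
Proof.
by rewrite /lip_dev homU homN homD homN homZ hom1 mulr1 subrr oppr0 maxxx.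
Qed.

(** The inequality amounts to the lattice equation [f `|` a *: 1 = f], which
    [phi] preserves. *)
Lemma hom_ge f (a : R) : (forall x, a <= f x) -> a <= phi f.
Proof.
move=> af; have : (f `|` a *: lip_unit X)%O = f.
  apply: lip_ext => x; rewrite lip_joinE; apply/max_idPl.
  by rewrite -[leLHS]/(a * 1) mulr1.
by move=> /(congr1 phi); rewrite homU homZ hom1 mulr1 => /max_idPl.
Qed.

(** This is where a homomorphism yields points of [X]; taking [f = 0] and
    [a = 1] shows that [X] is inhabited. *)
Lemma hom_lt_ex f (a : R) : phi f < a -> exists x, f x < a.
Proof.
move=> fa; apply: contrapT => /forallNP h.
by move: fa; rewrite ltNge hom_ge// => x; rewrite leNgt; apply/negP.
Qed.

(** The null functions of [phi] are stable under positive scaling, so the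
    threshold [1] stands for all thresholds [e > 0]: [h < e] is
    [e^-1 *: h < 1]. *)
Definition null_filter : set_system X :=
  filter_from [set h : Lip X | (forall x, 0 <= h x) /\ phi h = 0]
              (fun h => [set x | h x < 1]).

(** The sets [h < 1] and [k < 1] both contain [h + k < 1], and none of them is
    empty because [phi h = 0 < 1]. *)
Lemma null_filter_proper : ProperFilter null_filter.
Proof.
apply: filter_from_proper; last first.
  by move=> h [h0 ph]; apply: hom_lt_ex; rewrite ph.
apply: filter_from_filter; first by exists 0; split=> //; exact: hom0.
move=> h k [h0 ph] [k0 pk]; exists (h + k).
  split=> [x|]; last by rewrite homD ph pk addr0.
  by rewrite -[leRHS]/(h x + k x) addr_ge0.
move=> x /= hk; split => /=; apply: le_lt_trans hk.
  by rewrite -[leRHS]/(h x + k x) lerDl.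
by rewrite -[leRHS]/(h x + k x) lerDr.
Qed.

Lemma null_filter_near f (e : R) :
  0 < e -> null_filter [set x | `|f x - phi f| < e].
Proof.
move=> e0; exists (e^-1 *: lip_dev f (phi f)).
  split=> [x|]; last by rewrite homZ hom_dev mulr0.
  by rewrite -[leRHS]/(e^-1 * lip_dev f _ x) lip_devE mulr_ge0// invr_ge0 ltW.
move=> x /=; rewrite -[ltLHS]/(e^-1 * lip_dev f _ x) lip_devE.
by rewrite ltr_pdivrMl// mulr1.
Qed.

(** By continuity [f] is close to [f x] near the cluster point, and it is close
    to [phi f] on the sets of the filter, which meet every neighbourhood
    of [x]. *)
Lemma cluster_null_filter x f : cluster null_filter x -> f x = phi f.
Proof.
move=> clx; apply/eqP; rewrite -subr_eq0 -normr_eq0 eq_le normr_ge0 andbT.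
apply/ler_addgt0Pl => e e0; rewrite addr0.
have e20 : 0 < e / 2 by rewrite divr_gt0.
have fx : nbhs x [set y | `|f x - f y| < e / 2].
  by have /(_ x)/cvgrPdist_lt := @lip_continuous R X f; apply.
have [y [/= fy xy]] := clx _ _ (null_filter_near f e20) fx.
rewrite -(subrKA (f y)) (splitr e) (le_trans (ler_normD _ _))// ltW//.
exact: ltrD.
Qed.

(** The distance to [x0] is close to its value [c] under [phi] on a set of the
    filter, so the ball of radius [c + 1] belongs to the filter. *)
Lemma heine_borel_hom_eval : heine_borel X -> exists x, forall f, f x = phi f.
Proof.
move=> HB; have [x0 _] : exists x0, (0 : Lip X) x0 < 1.
  by apply: hom_lt_ex; rewrite hom0.
pose c := phi (dist_from x0); pose K := [set x | mdist x0 x <= c + 1].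
have cK : closed K.
  apply: (@preimage_closed _ _ (dist_from x0) [set t | t <= c + 1]).
    by move=> x _; exact: lip_continuous.
  exact: closed_le.
have bK : mbounded K.
  exists ((c + 1) + (c + 1)) => x y Kx Ky.
  by rewrite (le_trans (metric_triangle x x0 y))// lerD// metric_sym.
have KF : null_filter K.
  have PF := null_filter_proper.
  apply: filterS (null_filter_near (dist_from x0) ltr01) => x /=.
  by rewrite ltr_distl => /andP[_ /ltW].
have [x [_ clx]] := HB _ cK bK _ null_filter_proper KF.
by exists x => f; exact: cluster_null_filter.
Qed.

End Homomorphisms.

(** * The evaluation map *)

Section Realcompactification.
Context {R : realType} {X : metricType R}.

Lemma realcompactification_ext (p q : lip_realcompactification X) :
  (forall f, val p f = val q f) -> p = q.
Proof. by move=> pq; apply/val_inj/funext. Qed.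

Lemma lip_eval_inj : injective (@lip_eval R X).
Proof.
move=> x y /(congr1 (fun p => val p (dist_from x)))/=.
by rewrite mdistxx => /esym/mdist_positivity.
Qed.

(** The topology of pointwise convergence is initial for the coordinates, and
    the coordinates of the evaluation map are the Lipschitz functions. *)
Lemma lip_eval_continuous :
  continuous (@lip_eval R X : X -> lip_realcompactification X).
Proof.
apply: continuous_comp_initial => x; apply/cvg_sup => f U [V] [[W oW <-]] Wx WU.
apply: (filterS WU); apply: lip_continuous.
exact: open_nbhs_nbhs.
Qed.

Lemma realcompactification_proj_continuous (f : Lip X) :
  continuous (fun p : lip_realcompactification X => val p f).
Proof.
move=> p.
have vp : {for p, continuous
    (val : lip_realcompactification X -> {ptws Lip X -> R})}.
  exact: initial_continuous.
have pp : {for val p, continuous (proj f : {ptws Lip X -> R} -> R)}.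
  exact: (@proj_continuous (Lip X) (fun=> R) f).
exact: (continuous_comp vp pp).
Qed.

(** The distance from [g p] to [g q] is the value of [q] at [dist_from (g p)],
    and this coordinate is continuous in [q], with value [0] at [p]. *)
Lemma lip_eval_cancel_continuous (g : lip_realcompactification X -> X) :
  cancel g (@lip_eval R X) -> continuous g.
Proof.
move=> gK p; have Fp := nbhs_filter p.
apply/(@metricType_numDomainType.cvgrPdist_lt R X _ _ Fp) => e e0.
have /cvgrPdist_lt/(_ e e0) :=
  @realcompactification_proj_continuous (dist_from (g p)) p.
apply: filterS => q.
by rewrite -{1}(gK p) -{1}(gK q) /= mdistxx sub0r normrN ger0_norm ?mdist_ge0.
Qed.

Lemma heine_borel_realcompact : heine_borel X -> lipschitz_realcompact X.
Proof.
move=> HB; split; first exact: lip_eval_continuous.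
have ev_surj (p : lip_realcompactification X) : exists x, lip_eval x = p.
  have [x xp] := heine_borel_hom_eval (set_mem (valP p)) HB.
  by exists x; exact: realcompactification_ext.
pose g p := projT1 (cid (ev_surj p)).
have gK : cancel g (@lip_eval R X) by move=> p; exact: projT2 (cid (ev_surj p)).
exists g; split=> //; last exact: lip_eval_cancel_continuous.
exact: (inj_can_sym gK lip_eval_inj).
Qed.

(** * Limits along an ultrafilter on a bounded set *)

Section UltrafilterLimit.
Context {F : set_system X} {FU : UltraFilter F} {A : set X}.
Hypotheses (FA : F A) (bA : mbounded A).

Lemma lip_bounded_on (f : Lip X) : exists M, forall x, A x -> `|f x| <= M.
Proof.
have [x0 Ax0] := filter_ex FA.
have [k fk] := lipP f; have [M bM] := bA.
exists (`|k| * M + `|f x0|) => x Ax.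
rewrite -lerBlDr (le_trans (lerB_dist _ _))// (le_trans (fk _ _))//.
rewrite (le_trans (ler_wpM2r (mdist_ge0 _ _) (ler_norm k)))//.
by rewrite ler_wpM2l// bM.
Qed.

(** The image of [F] under [f] is an ultrafilter that lives on a compact
    segment. *)
Lemma ultra_lip_cvg (f : Lip X) : cvg (f @ F).
Proof.
have [M fM] := lip_bounded_on f.
have UfF : UltraFilter (f @ F).
  split=> [|G PG FG]; first exact: fmap_proper_filter.
  apply/seteqP; split=> // B GB.
  have [//|FnB] := in_ultra_setVsetC (f @^-1` B) FU.
  have /filter_ex[y []//] : G (B `&` ~` B) by apply: filterI => //; exact: FG.
have FM : F (f @^-1` `[- M, M]).
  by apply: filterS FA => x Ax /=; rewrite in_itv/= -ler_norml fM.
have := @segment_compact R (- M) M; rewrite compact_ultra.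
by move=> /(_ (f @ F) UfF FM)[l [_ fl]]; apply/cvg_ex; exists l.
Qed.

Lemma ultra_lim_hom : unital_lattice_hom (fun f : Lip X => lim (f @ F)).
Proof.
have cl (f : Lip X) : f @ F --> lim (f @ F) by exact: ultra_lip_cvg.
have Rh := @norm_hausdorff R R.
split=> [a f g|f g|f g|].
- apply: cvg_lim => //.
  by apply: cvgD; [apply: cvgM; [exact: cvg_cst|exact: cl]|exact: cl].
- apply: cvg_lim => //; rewrite (funext (lip_meetE f g)).
  apply: (@continuous2_cvg _ R R R _ _ f g Num.min _ _ _ (cl f) (cl g)).
  exact: (@min_continuous _ R (_, _)).
- apply: cvg_lim => //; rewrite (funext (lip_joinE f g)).
  apply: (@continuous2_cvg _ R R R _ _ f g Num.max _ _ _ (cl f) (cl g)).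
  exact: (@max_continuous _ R (_, _)).
- by apply: cvg_lim => //; exact: cvg_cst.
Qed.

End UltrafilterLimit.

(** Surjectivity of the evaluation map turns the limit homomorphism of an
    ultrafilter into a point, to which the ultrafilter then converges. *)
Lemma realcompact_heine_borel : lipschitz_realcompact X -> heine_borel X.
Proof.
move=> [_ [g [_ gK _]]] A cA bA; rewrite compact_ultra => F FU FA.
have limH := ultra_lim_hom (FU := FU) FA bA.
pose p : lip_realcompactification X :=
  exist _ (fun f : Lip X => lim (f @ F)) (mem_set limH).
have d0 : lim (dist_from (g p) @ F) = 0.
  by rewrite -[LHS]/(val p (dist_from (g p))) -{1}(gK p) /= mdistxx.
have dF : dist_from (g p) @ F --> (0 : R).
  by rewrite -d0; exact: (ultra_lip_cvg (FU := FU) FA bA).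
have Fx : F --> g p.
  apply/metricType_numDomainType.fcvgrPdist_lt => e e0.
  move/cvgrPdist_lt: dF => /(_ e e0); apply: filterS => y.
  by rewrite sub0r normrN ger0_norm ?mdist_ge0.
exists (g p); split=> //.
exact: (closed_cvg A cA FA _ Fx).
Qed.

End Realcompactification.

Theorem proposition5 (R : realType) (X : metricType R) :
  lipschitz_realcompact X <-> heine_borel X.
Proof.
by split; [exact: realcompact_heine_borel | exact: heine_borel_realcompact].
Qed.
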